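(* Let $T$ be a self-affine lattice tile such that $T+\mathbb Z^n$ is a tiling of $\mathbb R^n$, with neighbor graph $G=(V,E)$, and assume all neighbors are compatible. For $u\in V\setminus\{0\}$ the following are equivalent: (a) $B_u$ is a face of $T$; (b) $B_u\not\subseteq\bigcup_{v\in V\setminus\{0,u\}}B_v$; (c) there is a finite word $\mathbf w$ over $\{1,\dots,m\}$ which is the label sequence of some directed path in $G$ starting at $u$, but is not the label sequence of any directed path in $G$ starting at any $v\in V\setminus\{0,u\}$.
   Context: Setting: $M$ is an $n\times n$ integer matrix all of whose eigenvalues have modulus $>1$, $m=|\det M|$, $k_1,\dots,k_m\in\mathbb R^n$ with $k_j-k_1\in\mathbb Z^n$ forming a complete set of residues of $\mathbb Z^n$ modulo $M\mathbb Z^n$; $f_j(x)=M^{-1}(x+k_j)$, $T=\bigcup_j f_j(T)$ compact nonempty. $B_k=T\cap(T+k)$. Neighbor graph $G=(V,E)$: $V=\{k\in\mathbb Z^n:B_k\ne\emptyset\}$; for $k,k'\in V$, an edge from $k$ to $k'$ with label $i$ iff $k'=Mk+k_j-k_i$ for some $j$. The label sequence of a path $e_1e_2\dots$ is the sequence of labels of its edges. All neighbors are compatible if every vertex $k\ne0$ of $G$ has, for each $j\in\{1,\dots,m\}$, an incoming edge with label $j$. $B_k$ ($k\ne0$) is a face of $T$ if there are $x\in B_k$ and an open neighborhood $U$ of $x$ with $U\cap\partial T\subseteq B_k$ and $U\subseteq T\cup(T+k)$. *)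

(* Defs.v *)
From mathcomp Require Import all_boot all_algebra.
From Stdlib Require Import Reals ZArith.

Set Implicit Arguments.
Unset Strict Implicit.
Unset Printing Implicit Defensive.

Definition Vec (n : nat) := 'I_n -> R.
Definition ZVec (n : nat) := 'I_n -> Z.

Definition vadd n (x y : Vec n) : Vec n := fun i => Rplus (x i) (y i).
Definition vsub n (x y : Vec n) : Vec n := fun i => Rminus (x i) (y i).
Definition vscale n (a : R) (x : Vec n) : Vec n := fun i => Rmult a (x i).
Definition vzero n : Vec n := fun _ => R0.
Definition zvec n (z : ZVec n) : Vec n := fun i => IZR (z i).

Definition intR (z : int) : R :=
  match z with Posz k => INR k | Negz k => Ropp (INR k.+1) end.

Definition mulv n (M : 'M[int]_n) (x : Vec n) : Vec n :=
  fun i => \big[Rplus/R0]_(j < n) Rmult (intR (M i j)) (x j).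

Definition mdigits n (M : 'M[int]_n) : nat := absz (determinant M).

(* a + i b is an eigenvalue of M (as a complex matrix): there is a nonzero
   complex vector x + i y with M (x + i y) = (a + i b)(x + i y). *)
Definition is_eigenvalue n (M : 'M[int]_n) (a b : R) : Prop :=
  exists x y : Vec n, (x <> (@vzero n) \/ y <> @vzero n) /\
    mulv M x = vsub (vscale a x) (vscale b y) /\
    mulv M y = vadd (vscale b x) (vscale a y).

Definition expanding n (M : 'M[int]_n) : Prop :=
  forall a b, is_eigenvalue M a b -> Rlt R1 (Rplus (Rmult a a) (Rmult b b)).

Definition in_Zn n (x : Vec n) : Prop := exists z : ZVec n, x = zvec z.
Definition in_MZn n (M : 'M[int]_n) (x : Vec n) : Prop :=
  exists z : ZVec n, x = mulv M (zvec z).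

(* k_j - k_1 in Z^n, forming a complete set of residues of Z^n mod M Z^n
   (stated relative to an arbitrary reference digit j0). *)
Definition digit_set n (M : 'M[int]_n) (k : 'I_(mdigits M) -> Vec n) : Prop :=
  (forall i j, in_Zn (vsub (k i) (k j))) /\
  (forall i j, in_MZn M (vsub (k i) (k j)) -> i = j) /\
  (forall j0 (z : ZVec n), exists j, in_MZn M (vsub (zvec z) (vsub (k j) (k j0)))).

(* T = \bigcup_j f_j(T) with f_j(x) = M^{-1}(x + k_j) (M is invertible since
   expanding): x = f_j(y) iff M x = y + k_j. *)
Definition self_affine n (M : 'M[int]_n) (k : 'I_(mdigits M) -> Vec n)
  (T : Vec n -> Prop) : Prop :=
  forall x, T x <-> exists j, exists y, T y /\ mulv M x = vadd y (k j).

Definition sup_ball n (x : Vec n) (eps : R) (y : Vec n) : Prop :=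
  forall i, Rlt (Rabs (Rminus (y i) (x i))) eps.
Definition open_set n (U : Vec n -> Prop) : Prop :=
  forall x, U x -> exists eps, Rlt 0 eps /\ forall y, sup_ball x eps y -> U y.
Definition interior_set n (A : Vec n -> Prop) (x : Vec n) : Prop :=
  exists eps, Rlt 0 eps /\ forall y, sup_ball x eps y -> A y.
Definition boundary_set n (A : Vec n -> Prop) (x : Vec n) : Prop :=
  forall eps, Rlt 0 eps ->
    (exists y, sup_ball x eps y /\ A y) /\ (exists y, sup_ball x eps y /\ ~ A y).
Definition compact_set n (A : Vec n -> Prop) : Prop :=
  forall (I : Type) (U : I -> Vec n -> Prop),
    (forall i, open_set (U i)) -> (forall x, A x -> exists i, U i x) ->
    exists l : list I, forall x, A x -> exists i, List.In i l /\ U i x.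

Definition translate n (T : Vec n -> Prop) (k : ZVec n) (x : Vec n) : Prop :=
  T (vsub x (zvec k)).

Definition lattice_tiling n (T : Vec n -> Prop) : Prop :=
  (forall x, exists k, translate T k x) /\
  (forall k k' x, k <> k' -> interior_set (translate T k) x ->
     interior_set (translate T k') x -> False).

Definition B n (T : Vec n -> Prop) (k : ZVec n) (x : Vec n) : Prop :=
  T x /\ translate T k x.

Definition zvec0 n : ZVec n := fun _ => 0%Z.

Definition nbV n (T : Vec n -> Prop) (k : ZVec n) : Prop := exists x, B T k x.

Definition nbE n (M : 'M[int]_n) (k : 'I_(mdigits M) -> Vec n)
  (T : Vec n -> Prop) (a a' : ZVec n) (i : 'I_(mdigits M)) : Prop :=
  nbV T a /\ nbV T a' /\
  exists j, zvec a' = vadd (mulv M (zvec a)) (vsub (k j) (k i)).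

Fixpoint labels_path n (M : 'M[int]_n) (k : 'I_(mdigits M) -> Vec n)
  (T : Vec n -> Prop) (a : ZVec n) (w : list 'I_(mdigits M)) : Prop :=
  match w with
  | nil => True
  | cons i w' => exists a', nbE k T a a' i /\ labels_path k T a' w'
  end.

Definition all_neighbors_compatible n (M : 'M[int]_n)
  (k : 'I_(mdigits M) -> Vec n) (T : Vec n -> Prop) : Prop :=
  forall a, nbV T a -> a <> @zvec0 n ->
    forall j, exists a', nbE k T a' a j.

Definition is_face n (T : Vec n -> Prop) (a : ZVec n) : Prop :=
  exists x (U : Vec n -> Prop), B T a x /\ open_set U /\ U x /\
    (forall y, U y -> boundary_set T y -> B T a y) /\
    (forall y, U y -> T y \/ translate T a y).

(* Main.v *)
From mathcomp Require Import all_boot all_order all_algebra complex.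
From mathcomp Require Import Rstruct zify.
From Stdlib Require Import Reals ZArith Lra Lia.
From Stdlib Require Import Classical FunctionalExtensionality.
Require Import Defs.

(** The point [x = f_w(z)], [z] in [T], lies in the neighbor [T + v] only if [w]
    labels a path from [v]; conversely a path from [v] labelled [w] produces a
    point of [B_v] inside [f_w(T)].  This gives (c) => (b) at once, and (b) => (c)
    because the pieces [f_w(T)] shrink uniformly and the translates of [T] are
    locally finite.  Local finiteness also gives (b) => (a).  For (a) => (b), [T]
    is the closure of its interior, so a third tile through the point [x] of a
    face would overlap [T] or [T + u].

    The shrinking of [f_w(T)] amounts to [M^(-N) -> 0], which is deduced from the
    eigenvalue condition by Cayley-Hamilton: the factors of the characteristic
    polynomial are removed one at a time. *)

Set Implicit Arguments.
Unset Strict Implicit.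
Unset Printing Implicit Defensive.

Import Order.TTheory GRing.Theory Num.Theory.
Import ComplexField.Normc.

(** * Null sequences and backward orbits of a matrix *)

Lemma Un_cv_perturbed_contraction (q : R) (a e : nat -> R) :
  (0 <= q < 1)%R -> (forall N, (0 <= a N)%R) ->
  (forall N, (a N.+1 <= q * (a N + e N))%R) -> Un_cv e 0 -> Un_cv a 0.
Proof.
move=> [q0 q1] a0 rec ecv eps eps0.
(* With this error bound [eps / 2] is preserved by the recursion, since [q * (1 + (1 - q)) <= 1]
   amounts to [0 <= (1 - q)^2]. Only the geometric term [q ^ t * a N1] then remains to be made
   small. *)
have [N1 HN1] := ecv (eps * (1 - q) / 2)%R ltac:(nra).
have bnd (t : nat) : (a (t + N1)%nat <= q ^ t * a N1 + eps / 2)%R.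
  elim: t => [|t IH]; first by rewrite add0n /=; lra.
  have := rec (t + N1)%nat; have := HN1 (t + N1)%nat ltac:(lia).
  rewrite /Rdist Rminus_0_r => /Rabs_def2 [e1 _] rec1; rewrite addSn /=.
  have := Rmult_le_compat_l q (a (t + N1)%nat + e (t + N1)%nat)
    (q ^ t * a N1 + eps / 2 + eps * (1 - q) / 2) q0 ltac:(lra).
  have := Rmult_le_pos eps ((1 - q) * (1 - q)) ltac:(lra) ltac:(nra); lra.
have [N2 HN2] := pow_lt_1_zero q ltac:(rewrite Rabs_pos_eq; lra)
  (eps / 2 / (a N1 + 1))%R
  ltac:(apply: Rdiv_lt_0_compat; [lra | have := a0 N1; lra]).
exists (N2 + N1)%nat => m hm.
have -> : m = ((m - N1) + N1)%nat by lia.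
set t := (m - N1)%nat.
have := HN2 t ltac:(rewrite /t; lia); rewrite Rabs_pos_eq; last exact: pow_le.
move=> ht; have aN := a0 N1; have at0 := a0 (t + N1)%nat.
have h : (q ^ t * (a N1 + 1) < eps / 2)%R.
  apply: (Rlt_le_trans _ (eps / 2 / (a N1 + 1) * (a N1 + 1))%R).
    by apply: Rmult_lt_compat_r => //; lra.
  by apply: Req_le; field; lra.
have := bnd t; have := pow_le q t q0.
by rewrite /Rdist Rminus_0_r Rabs_pos_eq //; nra.
Qed.

Lemma Un_cv_sum0 (I : Type) (r : seq I) (F : I -> nat -> R) :
  (forall i, Un_cv (F i) 0) ->
  Un_cv (fun N => \big[Rplus/R0]_(i <- r) F i N) 0.
Proof.
move=> Fcv; elim: r => [|i r IH].
  by move=> eps eps0; exists 0%nat => m _; rewrite big_nil /Rdist Rminus_0_r Rabs_R0.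
apply: (Un_cv_ext (fun N => F i N + \big[Rplus/R0]_(j <- r) F j N)%R).
  by move=> N; rewrite big_cons.
by rewrite -(Rplus_0_l 0); exact: CV_plus.
Qed.

Lemma bigRplus_ge0 (I : finType) (P : pred I) (F : I -> R) :
  (forall i, (0 <= F i)%R) -> (0 <= \big[Rplus/R0]_(i | P i) F i)%R.
Proof. by move=> F0; elim/big_ind: _ => //; [lra | move=> *; lra]. Qed.

Lemma bigRplus_ge_term (I : finType) (F : I -> R) (i : I) :
  (forall i, (0 <= F i)%R) -> (F i <= \big[Rplus/R0]_j F j)%R.
Proof.
move=> F0; rewrite (bigD1 i) //=.
by have := bigRplus_ge0 (fun j => j != i) F0; lra.
Qed.

Local Open Scope ring_scope.

(* For an eigenvalue [z] put [Z = Y (A - z)]; then [Y_(N+1) = (Y_N - Z_(N+1)) / z],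
   and [Z] is again a backward orbit, annihilated by one factor less. *)
Lemma backward_orbit_cvg0 (p n : nat) (A : 'M[R[i]]_n.+1) (r : seq R[i])
    (Y : nat -> 'M[R[i]]_(p, n.+1)) :
  (forall N, Y N.+1 *m A = Y N) -> (forall z, z \in r -> (1 < normc z)%R) ->
  (forall N, Y N *m horner_mx A (\prod_(z <- r) ('X - z%:P)) = 0) ->
  forall i j, Un_cv (fun N => normc (Y N i j)) 0.
Proof.
elim: r Y => [|z r IH] Y YA hr Y0 i j.
  move=> eps eps0; exists 0%nat => N _; have := Y0 N.
  rewrite big_nil rmorph1 mulmx1 => ->; rewrite mxE normc0 /Rdist.
  by rewrite Rminus_0_r Rabs_R0.
have hz : (1 < normc z)%R by apply: hr; rewrite inE eqxx.
have z0 : z != 0.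
  by apply/eqP => z0; move: hz; rewrite z0 normc0; apply: Rlt_asym; exact: Rlt_0_1.
pose Z N := Y N *m (A - z%:M).
have Zcv : forall i j, Un_cv (fun N => normc (Z N i j)) 0.
  (* [A - z] commutes with [A], so [Z] is again a backward orbit. *)
  apply: IH => [N|y yr|N].
  - by rewrite /Z -mulmxA mulmxBl mul_scalar_mx -mul_mx_scalar -mulmxBr mulmxA YA.
  - by apply: hr; rewrite inE yr orbT.
  - have := Y0 N; rewrite big_cons rmorphM /= rmorphB /= horner_mx_X horner_mx_C.
    by rewrite mulmxA.
have YE N : Y N.+1 i j = z^-1 * (Y N i j - Z N.+1 i j).
  have -> : Y N i j - Z N.+1 i j = z * Y N.+1 i j.
    rewrite /Z mulmxBr YA mul_mx_scalar; rewrite 3!mxE.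
    by rewrite opprB addrC subrK.
  by rewrite mulrA mulVf // mul1r.
apply: (@Un_cv_perturbed_contraction (/ normc z)%R _ (fun N => normc (Z N.+1 i j))).
- split; first by apply/Rlt_le/Rinv_0_lt_compat; lra.
  by rewrite -Rinv_1; apply: Rinv_lt_contravar; lra.
- by move=> N; apply/RleP; case: (Y N i j) => x y; exact: sqrtr_ge0.
- move=> N; rewrite YE normcM normcV.
  apply: Rmult_le_compat_l; first by apply/Rlt_le/Rinv_0_lt_compat; lra.
  by apply/RleP; rewrite -(normcN (Z N.+1 i j)); exact: le_normcD.
- apply: (Un_cv_ext (fun N => normc (Z (N + 1)%coq_nat i j))).
    by move=> N; rewrite Nat.add_1_r.
  exact: (CV_shift' (fun N => normc (Z N i j)) 1 0 (Zcv i j)).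
Qed.

(** * Decay of the inverse powers of an expanding matrix *)

Definition rowv n (x : Vec n) : 'rV[R]_n := \row_j x j.

(** Transposed because [eigenvalue] refers to row vectors acted on from the right, whereas [mulv]
    acts on columns. *)
Definition tmxR n (M : 'M[int]_n) : 'M[R]_n := \matrix_(i, j) intR (M j i).

Lemma rowv_mulv n (M : 'M[int]_n) (x : Vec n) :
  rowv (mulv M x) = rowv x *m tmxR M.
Proof.
apply/rowP => i; rewrite !mxE; apply: eq_bigr => j _.
by rewrite !mxE; exact: Rmult_comm.
Qed.

Lemma rowv_iter_mulv n (M : 'M[int]_n.+1) (x : Vec n.+1) N :
  rowv (ssrnat.iter N (mulv M) x) = rowv x *m tmxR M ^+ N.
Proof.
elim: N => [|N IH]; first by rewrite expr0 mulmx1.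
by rewrite iterS rowv_mulv IH -mulmxA exprSr.
Qed.

(** The real and imaginary parts of a complex eigenvector are the pair required by [is_eigenvalue].
    The hypothesis bounds the squared modulus, and a square root gives the modulus. *)
Lemma expanding_eigenvalue_gt1 n (M : 'M[int]_n) (z : R[i]) :
  expanding M -> eigenvalue (map_mx (real_complex R) (tmxR M)) z ->
  (1 < normc z)%R.
Proof.
move=> hM /eigenvalueP [v vM v0].
have ab : (1 < complex.Re z * complex.Re z + complex.Im z * complex.Im z)%R.
  pose x : Vec n := fun i => complex.Re (v 0 i).
  pose y : Vec n := fun i => complex.Im (v 0 i).
  apply: hM; exists x, y; split.
    apply: NNPP => /not_or_and [/NNPP x0 /NNPP y0]; case/eqP: v0.
    apply/rowP => j; rewrite mxE; apply/eqP; rewrite eq_complex.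
    have xj : complex.Re (v 0 j) = 0 by exact: (congr1 (@^~ j) x0).
    have yj : complex.Im (v 0 j) = 0 by exact: (congr1 (@^~ j) y0).
    by rewrite xj yj !eqxx.
  have E i : (v *m map_mx (real_complex R) (tmxR M)) 0 i
      = Complex (mulv M x i) (mulv M y i).
    rewrite mxE /mulv.
    apply/eqP; rewrite eq_complex /=; apply/andP; split; apply/eqP.
      rewrite (raddf_sum (@complex.Re R : Rcomplex R -> R)); apply: eq_bigr => j _.
      rewrite !mxE /x /y; case: (v 0 j) => s t /=.
      by rewrite mulr0 subr0; exact: Rmult_comm.
    rewrite (raddf_sum (@complex.Im R : Rcomplex R -> R)); apply: eq_bigr => j _.
    rewrite !mxE /x /y; case: (v 0 j) => s t /=.
    by rewrite mulr0 add0r; exact: Rmult_comm.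
  split; apply: functional_extensionality => i; have := E i; rewrite vM mxE.
    by rewrite /vsub /vscale /x /y; case: z {vM} => a b; case: (v 0 i) => s t [<- _].
  rewrite /vadd /vscale /x /y; case: z {vM} => a b; case: (v 0 i) => s t [_ <-] /=.
  by rewrite addrC.
rewrite /normc; case: z ab {vM} => a b /= /RltP ab.
apply/RltP; rewrite -[X in (X < _)%O](sqrtr1 R) ltr_sqrt //.
exact: lt_trans ltr01 ab.
Qed.

(** A nontrivial kernel would make 0 an eigenvalue. *)
Lemma expanding_unitmx n (M : 'M[int]_n) : expanding M -> tmxR M \in unitmx.
Proof.
move=> hM; rewrite -(map_unitmx (real_complex R)) -row_free_unit -kermx_eq0.
apply: contraT => ker0.
have : eigenvalue (map_mx (real_complex R) (tmxR M)) 0.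
  by rewrite /eigenvalue /eigenspace raddf0 subr0.
move/(expanding_eigenvalue_gt1 hM); rewrite normc0 => h.
by case: (Rlt_asym _ _ h Rlt_0_1).
Qed.

Lemma expanding_mulv_surj n (M : 'M[int]_n) (y : Vec n) :
  expanding M -> exists x, mulv M x = y.
Proof.
move=> /expanding_unitmx U; exists (fun i => (rowv y *m invmx (tmxR M)) 0 i).
set x := (fun i => _); have xE : rowv x = rowv y *m invmx (tmxR M).
  by apply/rowP => i; rewrite mxE.
apply: functional_extensionality => i.
have /rowP /(_ i) := rowv_mulv M x.
by rewrite xE mulmxKV // !mxE.
Qed.

(** The inverse powers form a backward orbit of the complexified matrix. Its characteristic
    polynomial splits over the complex numbers and annihilates the orbit by Cayley-Hamilton. *)
Lemma expanding_invmx_cvg0 n (M : 'M[int]_n.+1) : expanding M ->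
  forall i j, Un_cv (fun N => Rabs ((invmx (tmxR M) ^+ N) i j)) 0.
Proof.
move=> hM i j; have U := expanding_unitmx hM.
set A := map_mx (real_complex R) (tmxR M).
pose Y N := map_mx (real_complex R) (invmx (tmxR M) ^+ N).
have [r rE] := closed_field_poly_normal (char_poly A).
move: rE; rewrite (monicP (char_poly_monic A)) scale1r => rE.
apply: (Un_cv_ext (fun N => normc (Y N i j))).
  move=> N; rewrite mxE /= expr0n addr0 sqrtr_sqr; by [].
apply: (@backward_orbit_cvg0 _ _ A r).
- by move=> N; rewrite /Y -map_mxM exprSr -mulmxA mulVmx // mulmx1.
- move=> z zr; apply: expanding_eigenvalue_gt1 hM _.
  by rewrite eigenvalue_root_char rE root_prod_XsubC.
- by move=> N; rewrite -rE Cayley_Hamilton mulmx0.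
Qed.

Lemma expanding_contraction n (M : 'M[int]_n) (D eps : R) :
  expanding M -> (0 < eps)%R -> exists N, forall d : Vec n,
    (forall i, (Rabs (ssrnat.iter N (mulv M) d i) <= D)%R) ->
    forall i, (Rabs (d i) < eps)%R.
Proof.
case: n M => [|n] M hM eps0; first by exists 0%nat => d _ [].
have U := expanding_unitmx hM; set B := invmx (tmxR M).
(* One scalar null sequence dominating every column sum of [B ^+ N]. *)
pose s N := \big[Rplus/R0]_(i < n.+1) \big[Rplus/R0]_(j < n.+1)
  Rabs ((B ^+ N) j i).
have scv : Un_cv s 0.
  by apply: Un_cv_sum0 => i; apply: Un_cv_sum0 => j; exact: expanding_invmx_cvg0.
(* [Rabs D + 1] is positive whatever the sign of [D]. *)
have [N HN] := scv (eps / (Rabs D + 1))%R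
  ltac:(apply: Rdiv_lt_0_compat => //; have := Rabs_pos D; lra).
exists N => d hd i.
have dE : rowv d = rowv (ssrnat.iter N (mulv M) d) *m B ^+ N.
  rewrite rowv_iter_mulv -mulmxA.
  have -> : tmxR M ^+ N *m B ^+ N = 1%:M.
    elim: N {HN hd} => [|N IH]; first by rewrite !expr0 mulmx1.
    by rewrite exprSr exprS -mulmxA (mulmxA (tmxR M)) mulmxV // mul1mx.
  by rewrite mulmx1.
have sum_ge0 t : (0 <= \big[Rplus/R0]_(j < n.+1) Rabs ((B ^+ N) j t))%R.
  by apply: bigRplus_ge0 => j; exact: Rabs_pos.
have le_s : (\big[Rplus/R0]_(j < n.+1) Rabs ((B ^+ N) j i) <= s N)%R.
  exact: (@bigRplus_ge_term _
    (fun t => \big[Rplus/R0]_(j < n.+1) Rabs ((B ^+ N) j t)) i).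
have di_le : (Rabs (d i) <= Rabs D * \big[Rplus/R0]_(j < n.+1) Rabs ((B ^+ N) j i))%R.
  have -> : d i = \big[Rplus/R0]_(j < n.+1)
      (ssrnat.iter N (mulv M) d j * (B ^+ N) j i)%R.
    have /rowP /(_ i) := dE; rewrite !mxE => ->.
    by apply: eq_bigr => j _; rewrite !mxE.
  elim/big_ind2: _ => [|x x' y y' hx hy|j _].
  - by rewrite Rabs_R0; lra.
  - by have := Rabs_triang x' y'; lra.
  - rewrite Rabs_mult; apply: Rmult_le_compat_r; first exact: Rabs_pos.
    by have := hd j; have := Rle_abs D; lra.
have := HN N (Nat.le_refl N); rewrite /Rdist Rminus_0_r => /Rabs_def2 [sN _].
have D0 := Rabs_pos D.
have : (s N * (Rabs D + 1) < eps)%R.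
  apply: (Rlt_le_trans _ (eps / (Rabs D + 1) * (Rabs D + 1))%R).
    by apply: Rmult_lt_compat_r => //; lra.
  by apply: Req_le; field; lra.
have := Rmult_le_compat_l _ _ _ D0 le_s.
have : (0 <= s N)%R by exact: bigRplus_ge0.
lra.
Qed.

Local Close Scope ring_scope.
Local Open Scope R_scope.

(** * Coordinate bounds and integer vectors *)

Lemma mulv_sub n (M : 'M[int]_n) (x y : Vec n) :
  mulv M (vsub x y) = vsub (mulv M x) (mulv M y).
Proof.
apply: functional_extensionality => i; rewrite /mulv /vsub.
elim/big_rec3: _ => [|j a b c _ ->]; lra.
Qed.

Lemma mulv_lipschitz n (M : 'M[int]_n) : exists L, 0 < L /\
  forall (c : R) (d : Vec n), 0 <= c -> (forall i, Rabs (d i) <= c) ->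
    forall i, Rabs (mulv M d i) <= L * c.
Proof.
pose s i := \big[Rplus/R0]_(j < n) Rabs (intR (M i j)).
have s0 i : 0 <= s i by apply: bigRplus_ge0 => j; exact: Rabs_pos.
(* The added 1 keeps the constant positive even if all entries vanish or [n = 0]. *)
exists (\big[Rplus/R0]_i s i + 1); split.
  by have := bigRplus_ge0 xpredT s0; lra.
move=> c d c0 hd i.
have : Rabs (mulv M d i) <= s i * c.
  rewrite /mulv /s; elim/big_rec2: _ => [|j a b _ IH]; first by rewrite Rabs_R0; lra.
  have := Rabs_triang (intR (M i j) * d j) b; rewrite Rabs_mult.
  have := Rmult_le_compat_l _ _ _ (Rabs_pos (intR (M i j))) (hd j); lra.
have := Rmult_le_compat_r c _ _ c0 (bigRplus_ge_term i s0); lra.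
Qed.

Lemma in_Zn_mulv n (M : 'M[int]_n) (z : ZVec n) : in_Zn (mulv M (zvec z)).
Proof.
have h i : exists t : Z, mulv M (zvec z) i = IZR t.
  rewrite /mulv; elim/big_ind: _ => [|a b [s ->] [t ->]|j _].
  - by exists 0%Z.
  - by exists (s + t)%Z; rewrite plus_IZR.
  - rewrite /zvec; case: (M i j) => m /=.
      by exists (Z.of_nat m * z j)%Z; rewrite mult_IZR INR_IZR_INZ.
    by exists (- Z.of_nat m.+1 * z j)%Z; rewrite mult_IZR opp_IZR -INR_IZR_INZ.
have [f hf] := fin_all_exists h.
by exists f; apply: functional_extensionality.
Qed.

Lemma in_Zn_add n (x y : Vec n) : in_Zn x -> in_Zn y -> in_Zn (vadd x y).
Proof.
move=> [a ->] [b ->]; exists (fun i => (a i + b i)%Z).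
by apply: functional_extensionality => i; rewrite /zvec plus_IZR.
Qed.

Lemma vec_bounded n (x : Vec n) : exists X, 0 <= X /\ forall i, Rabs (x i) <= X.
Proof.
have h i : 0 <= Rabs (x i) by exact: Rabs_pos.
exists (\big[Rplus/R0]_i Rabs (x i)); split; first exact: bigRplus_ge0.
by move=> i; exact: (@bigRplus_ge_term _ (fun i => Rabs (x i))).
Qed.

Lemma In_mem (I : eqType) (x : I) (s : seq I) : x \in s -> List.In x s.
Proof. by elim: s => //= a s IH; rewrite inE => /orP [/eqP ->|/IH]; auto. Qed.

Lemma bounded_ZVec_finite n (K : R) : exists L : list (ZVec n),
  forall z : ZVec n, (forall i, Rabs (zvec z i) <= K) -> List.In z L.
Proof.
have [m hm] := INR_unbounded K.
(* Vectors with coordinates in [[-m, m]] are coded by finite functions, each coordinate being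
   shifted by [m]. *)
pose c (f : {ffun 'I_n -> 'I_(2 * m).+1}) : ZVec n :=
  fun i => (Z.of_nat (f i) - Z.of_nat m)%Z.
exists (List.map c (enum {ffun 'I_n -> 'I_(2 * m).+1})) => z hz.
have zm i : (- Z.of_nat m <= z i <= Z.of_nat m)%Z.
  have := hz i; rewrite /zvec => zi; rewrite INR_IZR_INZ in hm.
  have [h1 h2] : - IZR (Z.of_nat m) <= IZR (z i) <= IZR (Z.of_nat m).
    have := Rle_abs (IZR (z i)); have := Rle_abs (- IZR (z i)).
    by rewrite Rabs_Ropp; lra.
  by rewrite -opp_IZR in h1; split; exact: le_IZR.
have -> : z = c [ffun i => inord (Z.to_nat (z i + Z.of_nat m))].
  apply: functional_extensionality => i; rewrite /c ffunE inordK.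
    by have := zm i; lia.
  by have := zm i; lia.
by apply: List.in_map; apply: In_mem; rewrite mem_enum.
Qed.

(** * Topology of the sup norm *)

Definition closed_set n (A : Vec n -> Prop) : Prop := open_set (fun x => ~ A x).

(** Stands in for the minimum of finitely many radii; it serves for coordinates, finite subcovers
    and finite families of tiles. *)
Lemma list_common_radius (I : Type) (l : list I) (P : I -> R -> Prop) :
  (forall i e e', e' <= e -> P i e -> P i e') ->
  (forall i, List.In i l -> exists e, 0 < e /\ P i e) ->
  exists e, 0 < e /\ forall i, List.In i l -> P i e.
Proof.
move=> mono; elim: l => [|i l IH] h; first by exists 1; split => //; lra.
have [e1 [e10 h1]] := h i (or_introl erefl).
have [e2 [e20 h2]] := IH (fun j hj => h j (or_intror hj)).
exists (Rmin e1 e2); split; first exact: Rmin_glb_lt.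
move=> j /= [<-|/h2]; first by apply: mono h1; exact: Rmin_l.
by apply: mono; exact: Rmin_r.
Qed.

Lemma sup_ball_center n (x : Vec n) e : 0 < e -> sup_ball x e x.
Proof. by move=> e0 i; rewrite Rminus_diag Rabs_R0. Qed.

Lemma sup_ball_open n (x : Vec n) e : open_set (sup_ball x e).
Proof.
move=> y hy.
have [i a b|i _|d [d0 hd]] := @list_common_radius _ (enum 'I_n)
  (fun i d => d <= e - Rabs (y i - x i)).
- lra.
- by exists (e - Rabs (y i - x i)); have := hy i; lra.
exists d; split=> // z hz i.
have iI : List.In i (enum 'I_n) by apply: In_mem; rewrite mem_enum.
have := hd i iI; have := hz i.
have := Rabs_triang (z i - y i) (y i - x i).
have -> : z i - y i + (y i - x i) = z i - x i by lra.
lra.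
Qed.

Lemma open_setI n (U V : Vec n -> Prop) :
  open_set U -> open_set V -> open_set (fun x => U x /\ V x).
Proof.
move=> oU oV x [/oU [a [a0 ha]] /oV [b [b0 hb]]].
exists (Rmin a b); split; first exact: Rmin_glb_lt.
move=> y hy; split; [apply: ha | apply: hb] => i.
  by apply: Rlt_le_trans (hy i) _; exact: Rmin_l.
by apply: Rlt_le_trans (hy i) _; exact: Rmin_r.
Qed.

(** For [x] outside [A], the exteriors of the closed balls of radius [1/(m+1)] about [x] cover [A].
    A finite subcover stays away from some ball about [x]. *)
Lemma compact_closed n (A : Vec n -> Prop) : compact_set A -> closed_set A.
Proof.
move=> cA x nAx.
have [|y Ay|l hl] := cA nat (fun m y => exists c, / (INR m + 1) < Rabs (y c - x c)).
- move=> m y [c hc]; exists (Rabs (y c - x c) - / (INR m + 1)); split; first lra.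
  move=> z hz; exists c; have := hz c; have := Rabs_triang (y c - z c) (z c - x c).
  rewrite (Rabs_minus_sym (z c) (y c)).
  have -> : y c - z c + (z c - x c) = y c - x c by lra.
  lra.
- have [c hc] : exists c, y c <> x c.
    apply: NNPP => h; apply: nAx.
    suff <- : y = x by [].
    apply: functional_extensionality => c; apply: NNPP => hc; apply: h.
    by exists c.
  have [N [hN N0]] := archimed_cor1 (Rabs (y c - x c)) ltac:(apply: Rabs_pos_lt; lra).
  exists N, c; apply: Rle_lt_trans hN; apply: Rinv_le_contravar; last lra.
  exact: lt_0_INR.
have [|i _|e [e0 he]] := @list_common_radius _ l (fun m e => e <= / (INR m + 1)).
- by move=> i a b h1 h2; lra.
- exists (/ (INR i + 1)); split; last lra.
  by apply: Rinv_0_lt_compat; have := pos_INR i; lra.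
exists e; split=> // y hy /hl [m [ml [c hc]]].
by have := he m ml; have := hy c; lra.
Qed.

Lemma compact_bounded n (A : Vec n -> Prop) : compact_set A ->
  exists D, 0 <= D /\ forall x, A x -> forall i, Rabs (x i) <= D.
Proof.
move=> cA.
have [|y Ay|l hl] := cA nat (fun m => sup_ball (@vzero n) (INR m)).
- by move=> m; exact: sup_ball_open.
- have [X [_ hX]] := vec_bounded y; have [m hm] := INR_unbounded X.
  by exists m => i; have := hX i; rewrite /vzero Rminus_0_r; lra.
(* The sum of the finitely many radii serves as an upper bound for each of them. *)
have [D [D0 hD]] : exists D, 0 <= D /\ forall m, List.In m l -> INR m <= D.
  elim: l {hl} => [|m l [D [D0 hD]]]; first by exists 0; split => //; lra.
  exists (INR m + D); have := pos_INR m; split; first lra.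
  by move=> k /= [<-|/hD]; lra.
exists D; split=> // x /hl [m [/hD mD hm]] i.
by have := hm i; rewrite /vzero Rminus_0_r; lra.
Qed.

(** * Lattice translates and finite closed covers *)

Lemma vsub_zvec0 n (x : Vec n) : vsub x (zvec (@zvec0 n)) = x.
Proof. by apply: functional_extensionality => i; rewrite /vsub /zvec /zvec0; lra. Qed.

Lemma sup_ball_vsub n (x y v : Vec n) e :
  sup_ball (vsub x v) e (vsub y v) <-> sup_ball x e y.
Proof.
by split=> h i; have := h i; rewrite /vsub;
  have -> : y i - v i - (x i - v i) = y i - x i by lra.
Qed.

Lemma closed_translate n (T : Vec n -> Prop) (v : ZVec n) :
  closed_set T -> closed_set (translate T v).
Proof.
move=> cT x /cT [e [e0 he]]; exists e; split=> // y hy.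
by apply: he; apply/sup_ball_vsub.
Qed.

Lemma interior_translate n (T : Vec n -> Prop) (v : ZVec n) x :
  interior_set (translate T v) x <-> interior_set T (vsub x (zvec v)).
Proof.
split=> [] [e [e0 he]]; exists e; split=> // y hy.
  have E : y = vsub (vadd y (zvec v)) (zvec v).
    by apply: functional_extensionality => i; rewrite /vsub /vadd; lra.
  by rewrite E; apply: he; apply/(sup_ball_vsub _ _ (zvec v)); rewrite -E.
by apply: he; apply/sup_ball_vsub.
Qed.

(** A finite form of Baire's theorem: if the first set does not fill the ball, its open complement
    contains a smaller ball, which the remaining sets must cover. *)
Lemma finite_closed_cover_interior n (I : Type) (l : list I)
    (F : I -> Vec n -> Prop) (x : Vec n) (e : R) :
  (forall i, closed_set (F i)) -> 0 < e ->
  (forall y, sup_ball x e y -> exists i, List.In i l /\ F i y) ->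
  exists i y, List.In i l /\ sup_ball x e y /\ interior_set (F i) y.
Proof.
move=> cF; elim: l x e => [|i l IH] x e e0 hl.
  by have [j [[]]] := hl x (sup_ball_center x e0).
have [h|h] := classic (forall y, sup_ball x e y -> F i y).
  exists i, x; split; [by left | split; first exact: sup_ball_center].
  by exists e.
have [y [xy nFy]] : exists y, sup_ball x e y /\ ~ F i y.
  apply: NNPP => h'; apply: h => y hy; apply: NNPP => nF; apply: h'.
  by exists y.
have [d [d0 hd]] := open_setI (@sup_ball_open _ x e) (cF i) (conj xy nFy).
have [z yz|j [z [jl [yz hz]]]] := IH y d d0.
  have [xz nFz] := hd z yz.
  by have [j [[<- /nFz|jl Fj]]] := hl z xz; exists j.
exists j, z; split; [by right | split=> //]; exact: (proj1 (hd z yz)).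
Qed.

Section BoundedClosed.

Variables (n : nat) (T : Vec n -> Prop) (D : R).
Hypotheses (cT : closed_set T) (bT : forall x, T x -> forall i, Rabs (x i) <= D).

(** Writing [v = (y - x) + x - (y - v)] with [y - v] in [T] bounds the coordinates of [v]. *)
Lemma translates_locally_finite (x : Vec n) (e : R) : exists L : list (ZVec n),
  forall v y, sup_ball x e y -> translate T v y -> List.In v L.
Proof.
have [X [_ hX]] := vec_bounded x.
have [L hL] := bounded_ZVec_finite n (D + (X + e)).
exists L => v y xy vy; apply: hL => i.
have := bT vy i; have := xy i; have := hX i; rewrite /vsub => h1 h2 h3.
have := Rabs_triang (y i - x i) (x i).
have -> : y i - x i + x i = y i by lra.
have := Rabs_triang (y i) (- (y i - zvec v i)); rewrite Rabs_Ropp.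
have -> : y i + - (y i - zvec v i) = zvec v i by lra.
lra.
Qed.

(** Only finitely many translates meet the unit ball about [x], and each closed one that misses [x]
    misses a ball about [x]. *)
Lemma translates_avoiding_nbhd (x : Vec n) (P : ZVec n -> Prop) :
  (forall v, P v -> ~ translate T v x) ->
  exists e, 0 < e /\ forall v y, P v -> sup_ball x e y -> ~ translate T v y.
Proof.
move=> hP; have [L hL] := translates_locally_finite x 1.
have [||e [e0 he]] := @list_common_radius _ L
    (fun v e => P v -> forall y, sup_ball x e y -> ~ translate T v y).
- move=> v e e' ee h Pv y xy; apply: (h Pv) => i.
  by have := xy i; lra.
- move=> v _; have [Pv|nPv] := classic (P v); last by exists 1; split=> //; lra.
  by have [e [e0 he]] := closed_translate cT (hP v Pv); exists e; split.
exists (Rmin 1 e); split; first by apply: Rmin_glb_lt => //; lra.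
move=> v y Pv xy vy.
have y1 : sup_ball x 1 y by move=> i; apply: Rlt_le_trans (xy i) _; exact: Rmin_l.
apply: (he v (hL v y y1 vy) Pv y _ vy) => i.
by apply: Rlt_le_trans (xy i) _; exact: Rmin_r.
Qed.

(** Finitely many translates cover the unit ball, so one of them has an interior point, which is
    translated back to [T]. *)
Lemma covering_interior_nonempty :
  (forall x, exists v, translate T v x) -> exists x, interior_set T x.
Proof.
move=> cov; have [L hL] := translates_locally_finite (@vzero n) 1.
have [||v [y [_ [_ hy]]]] := @finite_closed_cover_interior _ _ L
    (translate T) (@vzero n) 1 (fun v => closed_translate cT) _ _.
- lra.
- by move=> y hy; have [v vy] := cov y; exists v; split=> //; exact: hL vy.
by exists (vsub y (zvec v)); apply/interior_translate.
Qed.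

End BoundedClosed.

(** * Inverse branches and paths in the neighbor graph *)

Section Pushforward.

Variables (n : nat) (M : 'M[int]_n) (k : 'I_(mdigits M) -> Vec n)
  (T : Vec n -> Prop).

(* The inverse [x |-> M x - k_i] of [f_i]; along a word the letters are applied
   from left to right, so [push w] inverts [f_(w_1) o ... o f_(w_N)]. *)
Definition push1 (i : 'I_(mdigits M)) (x : Vec n) : Vec n :=
  vsub (mulv M x) (k i).

Definition push (w : seq 'I_(mdigits M)) (x : Vec n) : Vec n :=
  foldl (fun y i => push1 i y) x w.

(** The digits cancel in differences, leaving only the linear part. *)
Lemma push_sub w x y :
  vsub (push w x) (push w y) = ssrnat.iter (size w) (mulv M) (vsub x y).
Proof.
elim: w x y => //= i w IH x y; rewrite /push /= -/(push w _) -/(push w _) IH.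
rewrite -iterS iterSr mulv_sub; congr (ssrnat.iter _ _ _).
by apply: functional_extensionality => j; rewrite /push1 /vsub; lra.
Qed.

Hypotheses (hM : expanding M) (hk : digit_set k) (hT : self_affine k T).

Lemma push1_surj i y : exists x, push1 i x = y.
Proof.
have [x hx] := expanding_mulv_surj (vadd y (k i)) hM; exists x.
by apply: functional_extensionality => j; rewrite /push1 hx /vsub /vadd; lra.
Qed.

Lemma push_surj w y : exists x, push w x = y.
Proof.
elim: w => [|i w [z hz]] ; first by exists y.
by have [x hx] := push1_surj i z; exists x; rewrite /push /= hx.
Qed.

Lemma self_affine_push1 x : T x <-> exists i, T (push1 i x).
Proof.
rewrite hT; split=> [[i [y [Ty hy]]]|[i Ti]]; exists i.
  suff -> : push1 i x = y by [].
  by apply: functional_extensionality => j; rewrite /push1 hy /vsub /vadd; lra.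
exists (push1 i x); split=> //.
by apply: functional_extensionality => j; rewrite /push1 /vsub /vadd; lra.
Qed.

Lemma push_in w x : T (push w x) -> T x.
Proof.
elim: w x => // i w IH x /IH Ti.
by apply/self_affine_push1; exists i.
Qed.

Lemma push_exists N x : T x -> exists w, size w = N /\ T (push w x).
Proof.
elim: N x => [|N IH] x Tx; first by exists [::].
have [i /IH [w [sw Tw]]] := proj1 (self_affine_push1 x) Tx.
by exists (i :: w); rewrite /= sw.
Qed.

Lemma interior_push w x : interior_set T (push w x) -> interior_set T x.
Proof.
have step i y : interior_set T (push1 i y) -> interior_set T y.
  move=> [e [e0 he]]; have [L [L0 hL]] := mulv_lipschitz M.
  (* The factor 2 turns the weak Lipschitz bound into the strict inequality defining the ball. *)
  exists (e / (2 * L)); split; first by apply: Rdiv_lt_0_compat; lra.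
  move=> z hz; apply/self_affine_push1; exists i; apply: he => j.
  have -> : push1 i z j - push1 i y j = mulv M (vsub z y) j.
    by rewrite mulv_sub /push1 /vsub; lra.
  have := hL (e / (2 * L)) (vsub z y)
    ltac:(apply/Rlt_le/Rdiv_lt_0_compat; lra) (fun j => Rlt_le _ _ (hz j)) j.
  have -> : L * (e / (2 * L)) = e / 2 by field; lra.
  lra.
by elim: w x => // i w IH x /IH /step.
Qed.

(* If [x = f_w(z)] with [z] in [T], every tile [T + v] through [x] follows [w]
   down the neighbor graph. *)
Lemma labels_path_of_push w v x :
  T (push w x) -> translate T v x -> labels_path k T v w.
Proof.
elim: w v x => // i w IH v x Tw Tv.
have Ti : T (push1 i x) := @push_in w (push1 i x) Tw.
have [j Tj] := proj1 (self_affine_push1 _) Tv.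
(* The next vertex is forced by [(M x - k_i) - v' = M (x - v) - k_j], that is
   [v' = M v + k_j - k_i]. *)
have [v' hv'] : in_Zn (vadd (mulv M (zvec v)) (vsub (k j) (k i))).
  by apply: in_Zn_add; [exact: in_Zn_mulv | exact: (proj1 hk)].
have Tv' : translate T v' (push1 i x).
  rewrite /translate -hv'.
  suff <- : push1 j (vsub x (zvec v)) =
      vsub (push1 i x) (vadd (mulv M (zvec v)) (vsub (k j) (k i))) by [].
  rewrite /push1 mulv_sub; apply: functional_extensionality => t.
  by rewrite /vsub /vadd; lra.
exists v'; split; last exact: IH Tw Tv'.
split; last split; last by exists j.
  by exists x; split=> //; apply/self_affine_push1; exists i.
by exists (push1 i x).
Qed.

(** Induction from the end of the path: a point [y] of [B_(v')] is pulled back to [x = f_i(y)], and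
    the edge equation gives [x - v = f_j(y - v')], so [x] lies in both [T] and [T + v]. *)
Lemma labels_path_point w v : nbV T v -> labels_path k T v w ->
  exists x, B T v x /\ T (push w x).
Proof.
elim: w v => [|i w IH] v; first by move=> [x [Tx Tv]] _; exists x.
move=> _ [v' [[_ [nv' [j hj]]] /(IH _ nv') [y [[Ty Tvy] Tw]]]].
have [x hx] := push1_surj i y; exists x.
split; last by rewrite /push /= hx.
split; first by apply/self_affine_push1; exists i; rewrite hx.
apply/self_affine_push1; exists j.
suff -> : push1 j (vsub x (zvec v)) = vsub y (zvec v') by [].
rewrite hj -hx /push1 mulv_sub; apply: functional_extensionality => t.
by rewrite /vsub /vadd; lra.
Qed.

Variable D : R.
Hypothesis bT : forall x, T x -> forall i, Rabs (x i) <= D.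

(** The images of [x] and [y] under [push w] lie in [T], hence differ by at most [D + D] in each
    coordinate, and their difference is [M^N] applied to that of [x] and [y]. *)
Lemma push_contraction e : 0 < e -> exists N, forall w x y,
  size w = N -> T (push w x) -> T (push w y) -> sup_ball x e y.
Proof.
move=> e0; have [N hN] := expanding_contraction (D + D) hM e0.
exists N => w x y sw Tx Ty i; apply: (hN (vsub y x)) => j.
rewrite -sw -push_sub /vsub.
have := bT Tx j; have := bT Ty j.
have := Rabs_triang (push w y j) (- push w x j); rewrite Rabs_Ropp /Rminus; lra.
Qed.

(** A small piece [f_w(T)] containing [x] also contains [f_w(z)], which is interior to [T] when [z]
    is. *)
Lemma interior_dense x e : (exists z, interior_set T z) -> T x -> 0 < e ->
  exists y, sup_ball x e y /\ interior_set T y.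
Proof.
move=> [z hz] Tx /push_contraction [N hN].
have [w [sw Tw]] := push_exists N Tx; have [y hy] := push_surj w z.
exists y; split; last by apply: (@interior_push w); rewrite hy.
apply: hN sw Tw _; rewrite hy.
by have [d [d0 hd]] := hz; apply: hd; exact: sup_ball_center.
Qed.

End Pushforward.

(** * The equivalence of the three conditions *)

Theorem theorem9p3 (n : nat) (M : 'M[int]_n)
  (k : 'I_(mdigits M) -> Vec n) (T : Vec n -> Prop)
  (hM : expanding M) (hk : digit_set k)
  (hT : self_affine k T) (hTc : compact_set T) (hTne : exists x, T x)
  (htile : lattice_tiling T)
  (hcompat : all_neighbors_compatible k T)
  (u : ZVec n) (hu : nbV T u) (hu0 : u <> zvec0 (n:=n)) :
  (is_face T u <->
     exists x, B T u x /\
       forall v, nbV T v -> v <> zvec0 (n:=n) -> v <> u -> ~ B T v x) /\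
  ((exists x, B T u x /\
       forall v, nbV T v -> v <> zvec0 (n:=n) -> v <> u -> ~ B T v x) <->
   exists w : list 'I_(mdigits M), labels_path k T u w /\
       forall v, nbV T v -> v <> zvec0 (n:=n) -> v <> u -> ~ labels_path k T v w).
Proof.
have cT := compact_closed hTc; have [D [_ bT]] := compact_bounded hTc.
have [cov disj] := htile.
have intT := covering_interior_nonempty cT bT cov.
(* Near a point as in (b) only [T] and [T + u] occur: a further tile through [x] would automatically
   belong to a neighbor, as [x] is in [T]. *)
have avoid x : B T u x ->
    (forall v, nbV T v -> v <> zvec0 (n:=n) -> v <> u -> ~ B T v x) ->
    exists e, 0 < e /\ forall v y, v <> zvec0 (n:=n) /\ v <> u ->
      sup_ball x e y -> ~ translate T v y.
  move=> [Tx _] hx; apply: (translates_avoiding_nbhd cT bT) => v [v0 vu] Tv.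
  by apply: (hx v _ v0 vu); first exists x.
split; split.
- move=> [x [U [Bx [oU [Ux [_ UT]]]]]]; exists x; split=> // v _ v0 vu [_ Tv].
  have [e [e0 he]] := oU x Ux.
  (* (a) to (b): if [T + v] passes through [x], density of the interior at [x - v] yields a point
     [z] interior to [T + v] and still in the ball covered by [T] and [T + u]. *)
  have [y [xy iy]] := interior_dense hM hT bT intT Tv e0.
  set z := vadd y (zvec v).
  have zE : vsub z (zvec v) = y.
    by apply: functional_extensionality => i; rewrite /vsub /z /vadd; lra.
  have xz : sup_ball x e z by apply/(sup_ball_vsub _ _ (zvec v)); rewrite zE.
  have [d [d0 hd]] : interior_set (translate T v) z.
    by apply/interior_translate; rewrite zE.
  have [r [r0 hr]] := open_setI (@sup_ball_open _ x e) (@sup_ball_open _ z d)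
    (conj xz (sup_ball_center z d0)).
  (* Near [z] one of the two closed tiles has an interior point, which is then interior to [T + v]
     as well, against the tiling property. *)
  have [|t [s [ht [zs is_t]]]] := @finite_closed_cover_interior _ _
    [:: zvec0 (n:=n); u] (translate T) z r (fun v => closed_translate cT) r0.
    move=> s /hr [/he /UT [Ts|us] _]; last by exists u; split=> //; right; left.
    by exists (zvec0 (n:=n)); split; [left | rewrite /translate vsub_zvec0].
  apply: (disj t v s _ is_t).
    by case: ht => [<-|[<-|[]]] E; [apply: v0 | apply: vu].
  have [q [q0 hq]] := sup_ball_open (proj2 (hr s zs)).
  by exists q; split=> // p /hq /hd.
(* (b) to (a): the ball given by [avoid] is the neighborhood required of a face. *)
- move=> [x [Bx /(avoid x Bx) [e [e0 he]]]].
  have cover y : sup_ball x e y -> T y \/ translate T u y.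
    move=> xy; have [v vy] := cov y.
    have [v0|v0] := classic (v = zvec0 (n:=n)).
      by left; move: vy; rewrite v0 /translate vsub_zvec0.
    have [<-|vu] := classic (v = u); first by right.
    by case: (he v y (conj v0 vu) xy).
  exists x, (sup_ball x e); split=> //; split; first exact: sup_ball_open.
  split; first exact: sup_ball_center.
  split=> // y xy bd; have [d [d0 hd]] := sup_ball_open xy.
  split; apply: NNPP.
    by move=> /cT [c [c0 hc]]; have [[p [/hc]]] := bd c c0.
  (* If [y] were outside [T + u], a small ball about [y] would miss [T + u] and hence lie in [T], so
     [y] would not be a boundary point. *)
  move=> /(closed_translate cT) [c [c0 hc]].
  have [_ [p [yp nTp]]] := bd (Rmin c d) (Rmin_glb_lt _ _ _ c0 d0).
  have yc : sup_ball y c p by move=> i; apply: Rlt_le_trans (yp i) (Rmin_l _ _).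
  have yd : sup_ball y d p by move=> i; apply: Rlt_le_trans (yp i) (Rmin_r _ _).
  by case: (cover p (hd p yd)) => [/nTp|/(hc p yc)].
- move=> [x [Bx /(avoid x Bx) [e [e0 he]]]].
  (* (b) to (c): take a piece [f_w(T)] through [x] smaller than the radius [e]. A path from [v]
     labelled [w] would put a point of [T + v] into that piece. *)
  have [N hN] := push_contraction k hM bT e0.
  have [w [sw Tw]] := push_exists hT N (proj1 Bx).
  exists w; split; first exact: (labels_path_of_push hk hT Tw (proj2 Bx)).
  move=> v nv v0 vu /(labels_path_point hM hT nv) [y [[_ Tv] Ty]].
  exact: (he v y (conj v0 vu) (hN w x y sw Tw Ty)).
(* (c) to (b): the path from [u] yields [x] in [B_u] and in [f_w(T)]; any other tile through [x]
   would follow the same word. *)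
- move=> [w [/(labels_path_point hM hT hu) [x [Bx Tw]] hw]].
  exists x; split=> // v nv v0 vu [_ Tv].
  exact: (hw v nv v0 vu (labels_path_of_push hk hT Tw Tv)).
Qed.
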